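(* Let $(X,d)$ be a metric space, $A\subset X$ a nonempty closed set, and $\rho(x)=d(x,A)$ for $x\in X$. For $\varphi\in\ell_\infty(A)$ and $x\in X\setminus A$, let $\eta_{x,\varphi}:(0,+\infty)\to\mathbb{R}$ be the bounded increasing function $$\eta_{x,\varphi}(t)=\begin{cases}\sup\{\varphi(a): a\in A,\ d(a,x)<t\} &\text{if } t>\rho(x),\\ \inf_{a\in A}\varphi(a) &\text{if } t\le\rho(x).\end{cases}$$ Define $\Phi[\varphi]:X\to\mathbb{R}$ by $\Phi[\varphi](x)=\varphi(x)$ for $x\in A$ and $$\Phi[\varphi](x)=\frac1{\rho(x)}\int_{\rho(x)}^{2\rho(x)}\eta_{x,\varphi}(t)\,dt,\quad x\in X\setminus A.$$ Then the extension operator $\Phi:\ell_\infty(A)\to\ell_\infty(X)$ is a sublinear isotone isometry which preserves both continuity and uniform continuity.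
   Context: $d(x,A)=\inf\{d(x,a):a\in A\}$; subsets of $X$ carry the restricted metric. For a nonempty set $Z$, $\ell_\infty(Z)$ is the space of all bounded real-valued functions on $Z$ with the sup-norm $\|\varphi\|=\sup|\varphi|$ and the pointwise order. The integral is the Riemann integral. An operator $\Phi:\ell_\infty(A)\to\ell_\infty(X)$ is: an extension operator if $\Phi[\varphi]\upharpoonright A=\varphi$ for all $\varphi$; sublinear if $\Phi[\varphi+\psi]\le\Phi[\varphi]+\Phi[\psi]$ and $\Phi[\lambda\varphi]=\lambda\Phi[\varphi]$ for all $\varphi,\psi\in\ell_\infty(A)$ and $\lambda\ge0$; isotone if $\varphi\le\psi$ implies $\Phi[\varphi]\le\Phi[\psi]$; an isometry if $\|\Phi[\varphi]-\Phi[\psi]\|=\|\varphi-\psi\|$ for all $\varphi,\psi$. It preserves continuity (respectively, uniform continuity) if $\Phi[\varphi]$ is continuous (respectively, uniformly continuous) on $X$ whenever $\varphi\in\ell_\infty(A)$ is continuous (respectively, uniformly continuous) on $A$. *)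

(* Defs.v *)
From Stdlib Require Import Reals ClassicalEpsilon ProofIrrelevance.
From Coquelicot Require Import Coquelicot.

Open Scope R_scope.

(* Coquelicot's [closed] applies to its [UniformSpace], not to [Metric_Space]. *)
Definition is_closed (X : Metric_Space) (A : Base X -> Prop) : Prop :=
  forall x, ~ A x ->
    exists eps, 0 < eps /\ forall y, dist X x y < eps -> ~ A y.

Section Subspace.
Variables (X : Metric_Space) (A : Base X -> Prop).

Let sdist (a b : {x | A x}) : R := dist X (proj1_sig a) (proj1_sig b).

Lemma sdist_refl (a b : {x | A x}) : sdist a b = 0 <-> a = b.
Proof.
unfold sdist; rewrite dist_refl; split.
- destruct a as [a Ha], b as [b Hb]; simpl; intros ->.
  now rewrite (proof_irrelevance _ Ha Hb).
- now intros ->.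
Qed.

Definition subspace : Metric_Space :=
  Build_Metric_Space {x | A x} sdist
    (fun a b => dist_pos X (proj1_sig a) (proj1_sig b))
    (fun a b => dist_sym X (proj1_sig a) (proj1_sig b))
    sdist_refl
    (fun a b c => dist_tri X (proj1_sig a) (proj1_sig b) (proj1_sig c)).
End Subspace.

Definition continuous_on_space (X : Metric_Space) (f : Base X -> R) : Prop :=
  forall x, limit_in X R_met f (fun _ => True) x (f x).

Definition unif_continuous_on_space (X : Metric_Space) (f : Base X -> R) : Prop :=
  forall eps, 0 < eps ->
    exists delta, 0 < delta /\
      forall x y, dist X x y < delta -> Rabs (f x - f y) < eps.

(* [real] sends infinite values to 0, so [Rsup] and [Rinf] have their usual
   meaning only on nonempty sets bounded from above, resp. from below. *)
Definition Rsup (E : R -> Prop) : R := real (Lub_Rbar E).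
Definition Rinf (E : R -> Prop) : R := real (Glb_Rbar E).

Definition ell_inf {Z : Type} (phi : Z -> R) : Prop :=
  exists M, forall z, Rabs (phi z) <= M.

Definition sup_norm {Z : Type} (phi : Z -> R) : R :=
  Rsup (fun r => exists z, r = Rabs (phi z)).

(* An operator from ell_inf(Y) to ell_inf(Z) is represented by a map on all
   real-valued functions; only its values on bounded functions are considered. *)
Definition operator (Y Z : Type) : Type := (Y -> R) -> (Z -> R).

Definition maps_ell_inf {Y Z : Type} (F : operator Y Z) : Prop :=
  forall phi, ell_inf phi -> ell_inf (F phi).

Definition sublinear {Y Z : Type} (F : operator Y Z) : Prop :=
  (forall phi psi, ell_inf phi -> ell_inf psi ->
     forall z, F (fun y => phi y + psi y) z <= F phi z + F psi z) /\
  (forall lambda phi, 0 <= lambda -> ell_inf phi ->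
     forall z, F (fun y => lambda * phi y) z = lambda * F phi z).

Definition isotone {Y Z : Type} (F : operator Y Z) : Prop :=
  forall phi psi, ell_inf phi -> ell_inf psi ->
    (forall y, phi y <= psi y) -> forall z, F phi z <= F psi z.

Definition isometry {Y Z : Type} (F : operator Y Z) : Prop :=
  forall phi psi, ell_inf phi -> ell_inf psi ->
    sup_norm (fun z => F phi z - F psi z) = sup_norm (fun y => phi y - psi y).

Section Extension.
Variables (X : Metric_Space) (A : Base X -> Prop).

Definition extension_operator (F : operator {x | A x} (Base X)) : Prop :=
  forall phi, ell_inf phi -> forall a : {x | A x}, F phi (proj1_sig a) = phi a.

Definition preserves_continuity (F : operator {x | A x} (Base X)) : Prop :=
  forall phi, ell_inf phi ->
    continuous_on_space (subspace X A) phi -> continuous_on_space X (F phi).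

Definition preserves_unif_continuity (F : operator {x | A x} (Base X)) : Prop :=
  forall phi, ell_inf phi ->
    unif_continuous_on_space (subspace X A) phi ->
    unif_continuous_on_space X (F phi).

Definition dist_to_set (x : Base X) : R :=
  Rinf (fun r => exists a, A a /\ r = dist X x a).

Definition eta (phi : {x | A x} -> R) (x : Base X) (t : R) : R :=
  if Rlt_dec (dist_to_set x) t
  then Rsup (fun r => exists a : {x | A x}, dist X (proj1_sig a) x < t /\ r = phi a)
  else Rinf (fun r => exists a : {x | A x}, r = phi a).

Definition Phi : operator {x | A x} (Base X) := fun phi x =>
  match excluded_middle_informative (A x) with
  | left Ax => phi (exist _ x Ax)
  | right _ =>
      / dist_to_set x * RInt (eta phi x) (dist_to_set x) (2 * dist_to_set x)
  end.

(* The facts implicit in the definition of [Phi] outside A: [eta phi x] is a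
   bounded increasing function on (0, +oo), and the integral, for which
   Coquelicot's total [RInt] is used, exists. *)
Definition eta_well_behaved (phi : {x | A x} -> R) (x : Base X) : Prop :=
  (exists M, forall t, 0 < t -> Rabs (eta phi x t) <= M) /\
  (forall s t, 0 < s -> s <= t -> eta phi x s <= eta phi x t) /\
  ex_RInt (eta phi x) (dist_to_set x) (2 * dist_to_set x).
End Extension.

(* Main.v *)
Require Import Defs.
From Stdlib Require Import Reals ClassicalEpsilon ProofIrrelevance Lra.
From Coquelicot Require Import Coquelicot.

(** Every property of [Phi] is read off from one description of it: outside
    [A], [Phi phi x] is the average over [rho x < t < 2 * rho x] of the suprema
    of [phi] over the parts [{a : A | d(a,x) < t}] of [A], where [rho x] is the
    distance from [x] to [A].

    The algebraic properties hold because, for each such [t], the supremum over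
    a fixed nonempty set is a sublinear isotone function of [phi], and averaging
    keeps this ([Phi_sublinear], [Phi_isotone]).  As [Phi] moreover does not
    enlarge constants, [phi <= psi + c] gives [Phi phi <= Phi psi + c], so that
    [Phi] is nonexpanding; it is an isometry because it extends functions.

    Continuity has two sources.  Near [A], the value [Phi phi x] only involves
    points of [A] within [2 * rho x] of [x], so it lies between any two bounds
    for [phi] on these points ([Phi_local_bounds]); at a point [z] close to
    [a] in [A] all these points are close to [a], and [Phi phi z] is close to
    [phi a] ([Phi_near_set]).  Away from [A], the continuity comes from the
    averaging and holds for every bounded [phi]: by the triangle inequality
    [eta phi y t <= eta phi x (t + d(x,y))], and since moreover [rho] is
    1-Lipschitz, the integrals [rho x * Phi phi x] and [rho y * Phi phi y]
    compare after moving the ends of the interval by a multiple of [d(x,y)].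
    This gives a Lipschitz estimate with constant [6 * M / rho x], where [M]
    bounds [|phi|] ([Phi_lipschitz_off_set]).  For uniform continuity one uses the
    first estimate where [rho] is small and the second where it is not.

    The integral exists because [eta phi x] is monotone. *)

(** * Riemann integrability of monotone functions *)

(** On a fine tagged subdivision the Riemann sums of [f] and [g] differ by at
    most the Riemann sum of [h], which is close to an integral less than [eps];
    hence the Riemann sums of [f] satisfy the Cauchy criterion. *)
Lemma ex_RInt_squeeze (f : R -> R) (a b : R) :
  a <= b ->
  (forall eps, 0 < eps -> exists g h,
     ex_RInt g a b /\ ex_RInt h a b /\
     (forall t, a <= t <= b -> Rabs (f t - g t) <= h t) /\
     RInt h a b < eps) ->
  ex_RInt f a b.
Proof.
intros Hab H.
destruct (Req_dec a b) as [<-|Hne]; [apply ex_RInt_point|].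
pose (S := fun (f : R -> R) ptd => scal (sign (b - a)) (Riemann_sum f ptd)).
assert (HS : forall k p, S k p = Riemann_sum k p).
{ intros k p. unfold S. rewrite sign_eq_1 by lra. apply (scal_one (Riemann_sum k p)). }
apply (proj1 (filterlim_locally_cauchy (F := Riemann_fine a b) (U := R_CompleteSpace) (S f))).
intros eps.
destruct (H (eps / 6)) as (g & h & Hg & Hh & Hfg & Hint).
{ destruct eps as [e He]; simpl; lra. }
apply (RInt_correct (V := R_CompleteNormedModule)) in Hh.
apply (RInt_correct (V := R_CompleteNormedModule)) in Hg.
assert (He : 0 < eps / 6) by (destruct eps as [e He]; simpl; lra).
pose (e6 := mkposreal _ He).
pose proof (proj1 (filterlim_locally (F := Riemann_fine a b) (S h) _) Hh) as Ph.
pose proof (proj1 (filterlim_locally (F := Riemann_fine a b) (S g) _) Hg) as Pg.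
specialize (Ph e6).
specialize (Pg e6).
pose (tagged := fun ptd : @SF_seq R => pointed_subdiv ptd /\
   SF_h ptd = Rmin a b /\ seq.last (SF_h ptd) (SF_lx ptd) = Rmax a b).
assert (Pt : Riemann_fine a b tagged).
{ unfold Riemann_fine, within.
  apply filter_forall. intros x Hx. exact Hx. }
exists (fun p => (ball (RInt h a b) e6 (S h p) /\ ball (RInt g a b) e6 (S g p)) /\ tagged p).
split.
{ apply filter_and; [apply filter_and|]; assumption. }
assert (key : forall p, (ball (RInt h a b) e6 (S h p) /\ ball (RInt g a b) e6 (S g p)) /\ tagged p
   -> Rabs (S f p - RInt g a b) < 3 * (eps / 6)).
{ intros p [[B1 B2] [T1 [T2 T3]]].
  rewrite HS in B1, B2. rewrite HS.
  assert (Hn : Rabs (Riemann_sum f p - Riemann_sum g p) <= Riemann_sum h p).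
  { replace (Riemann_sum f p - Riemann_sum g p)
      with (Riemann_sum (V := R_NormedModule) (fun t => minus (f t) (g t)) p)
      by exact (Riemann_sum_minus f g p).
    apply (Riemann_sum_norm (V := R_NormedModule)); [exact T1|].
    rewrite Rmin_left in T2 by lra. rewrite Rmax_right in T3 by lra.
    intros t Ht. apply Hfg. rewrite <- T2, <- T3. exact Ht. }
  change (Rabs (Riemann_sum h p - RInt h a b) < eps / 6) in B1.
  change (Rabs (Riemann_sum g p - RInt g a b) < eps / 6) in B2.
  assert (arith : forall u v w I J e, Rabs (w - J) < e -> Rabs (v - I) < e ->
    Rabs (u - v) <= w -> J < e -> Rabs (u - I) < 3 * e).
  { clear; intros u v w I J e. unfold Rabs; repeat destruct Rcase_abs; intros; lra. }
  exact (arith _ _ _ _ _ _ B1 B2 Hn Hint). }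
intros u v Hu Hv.
apply key in Hu; apply key in Hv.
change (Rabs (S f v - S f u) < eps).
revert Hu Hv. unfold Rabs; repeat destruct Rcase_abs; intros; lra.
Qed.

Lemma ex_RInt_glue (g1 g2 : R -> R) (a m b : R) :
  a <= m <= b -> ex_RInt g1 a m -> ex_RInt g2 m b ->
  let g := fun t => if Rle_dec t m then g1 t else g2 t in
  ex_RInt g a b /\ RInt g a b = RInt g1 a m + RInt g2 m b.
Proof.
intros Hm H1 H2 g.
assert (E1 : forall t, Rmin a m < t < Rmax a m -> g1 t = g t).
{ intros t Ht. rewrite Rmin_left, Rmax_right in Ht by lra.
  unfold g; destruct Rle_dec; lra. }
assert (E2 : forall t, Rmin m b < t < Rmax m b -> g2 t = g t).
{ intros t Ht. rewrite Rmin_left, Rmax_right in Ht by lra.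
  unfold g; destruct Rle_dec; lra. }
assert (I1 : ex_RInt g a m) by exact (ex_RInt_ext _ _ _ _ E1 H1).
assert (I2 : ex_RInt g m b) by exact (ex_RInt_ext _ _ _ _ E2 H2).
split; [exact (ex_RInt_Chasles _ _ _ _ I1 I2)|].
rewrite (RInt_ext _ _ _ _ E1), (RInt_ext _ _ _ _ E2).
symmetry; exact (RInt_Chasles _ _ _ _ I1 I2).
Qed.

(** Starting from the constant [f a] with error [f b - f a], each bisection of
    the interval halves the integral of the error: on the halves the increments
    of [f] add up to [f b - f a] while the lengths are halved. *)
Lemma monotone_step_approximation (f : R -> R) (n : nat) (a b : R) :
  a <= b ->
  (forall s t, a <= s -> s <= t -> t <= b -> f s <= f t) ->
  exists g h,
    ex_RInt g a b /\ ex_RInt h a b /\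
    (forall t, a <= t <= b -> Rabs (f t - g t) <= h t) /\
    RInt h a b = (b - a) * (f b - f a) / 2 ^ n.
Proof.
revert a b; induction n as [|n IH]; intros a b Hab Hf.
- exists (fun _ => f a), (fun _ => f b - f a).
  split; [apply ex_RInt_const|]. split; [apply ex_RInt_const|]. split.
  + intros t Ht.
    assert (f a <= f t) by (apply Hf; lra).
    assert (f t <= f b) by (apply Hf; lra).
    rewrite Rabs_pos_eq; lra.
  + rewrite RInt_const. unfold scal; simpl; unfold mult; simpl. field.
- pose (m := (a + b) / 2).
  destruct (IH a m) as (g1 & h1 & Hg1 & Hh1 & Hd1 & Hi1).
  { unfold m; lra. }
  { intros s t ? ? ?; apply Hf; unfold m in *; lra. }
  destruct (IH m b) as (g2 & h2 & Hg2 & Hh2 & Hd2 & Hi2).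
  { unfold m; lra. }
  { intros s t ? ? ?; apply Hf; unfold m in *; lra. }
  assert (Hm : a <= m <= b) by (unfold m; lra).
  destruct (ex_RInt_glue _ _ _ _ _ Hm Hg1 Hg2) as [Ig _].
  destruct (ex_RInt_glue _ _ _ _ _ Hm Hh1 Hh2) as [Ih Eh].
  do 2 eexists; split; [exact Ig|]; split; [exact Ih|]; split.
  + intros t Ht; simpl; destruct Rle_dec; [apply Hd1|apply Hd2]; lra.
  + rewrite Eh, Hi1, Hi2. unfold m; simpl; field. apply pow_nonzero; lra.
Qed.

Lemma ex_RInt_monotone (f : R -> R) (a b : R) :
  a <= b ->
  (forall s t, a <= s -> s <= t -> t <= b -> f s <= f t) ->
  ex_RInt f a b.
Proof.
intros Hab Hf. apply ex_RInt_squeeze; [exact Hab|].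
intros eps Heps.
destruct (Pow_x_infinity 2) with (b := ((b - a) * (f b - f a)) / eps + 1) as [n Hn].
{ rewrite Rabs_pos_eq; lra. }
destruct (monotone_step_approximation f n a b Hab Hf) as (g & h & Hg & Hh & Hd & Hi).
exists g, h. repeat split; trivial.
rewrite Hi.
specialize (Hn n (Nat.le_refl n)).
assert (0 < 2 ^ n) by (apply pow_lt; lra).
rewrite Rabs_pos_eq in Hn by lra.
apply (Rmult_lt_reg_r (2 ^ n)); [lra|].
replace ((b - a) * (f b - f a) / 2 ^ n * 2 ^ n) with ((b - a) * (f b - f a)) by (field; lra).
apply (Rmult_lt_reg_r (/ eps)); [apply Rinv_0_lt_compat; lra|].
replace (eps * 2 ^ n * / eps) with (2 ^ n) by (field; lra).
unfold Rdiv in Hn; lra.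
Qed.

(** * Estimates for integrals *)

Lemma Rabs_RInt_le (f : R -> R) (M a b : R) :
  (forall t, Rabs (f t) <= M) -> ex_RInt f a b ->
  Rabs (RInt f a b) <= M * Rabs (b - a).
Proof.
intros HM Hf. destruct (Rle_dec a b) as [H|H].
- rewrite (Rabs_pos_eq (b - a)) by lra. rewrite Rmult_comm.
  apply abs_RInt_le_const; auto.
- apply ex_RInt_swap in Hf.
  rewrite <- (opp_RInt_swap f b a Hf), (Rabs_left (b - a)) by lra.
  change (Rabs (- RInt f b a) <= M * - (b - a)). rewrite Rabs_Ropp.
  replace (M * - (b - a)) with ((a - b) * M) by ring.
  apply abs_RInt_le_const; auto; lra.
Qed.

Lemma RInt_change_bounds (f : R -> R) (M a b a' b' : R) :
  (forall t, Rabs (f t) <= M) -> (forall u v, ex_RInt f u v) ->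
  RInt f a' b' <= RInt f a b + M * (Rabs (a' - a) + Rabs (b' - b)).
Proof.
intros HM Hf.
pose proof (RInt_Chasles f a' a b' (Hf _ _) (Hf _ _)) as E1.
pose proof (RInt_Chasles f a b b' (Hf _ _) (Hf _ _)) as E2.
unfold plus in E1, E2; simpl in E1, E2.
pose proof (Rabs_RInt_le f M a' a HM (Hf _ _)) as B1.
pose proof (Rabs_RInt_le f M b b' HM (Hf _ _)) as B2.
rewrite Rabs_minus_sym in B1.
pose proof (Rle_abs (RInt f a' a)). pose proof (Rle_abs (RInt f b b')).
lra.
Qed.

Lemma RInt_translate (f : R -> R) (d a b : R) :
  ex_RInt f (a + d) (b + d) ->
  ex_RInt (fun t => f (t + d)) a b /\
  RInt (fun t => f (t + d)) a b = RInt f (a + d) (b + d).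
Proof.
intros H.
assert (E : forall t, scal 1 (f (1 * t + d)) = f (t + d)).
{ intros t. unfold scal; simpl; unfold mult; simpl. now rewrite !Rmult_1_l. }
rewrite <- (Rmult_1_l a), <- (Rmult_1_l b) in H.
split.
- eapply ex_RInt_ext; [intros t _; apply E|]. exact (ex_RInt_comp_lin f 1 d a b H).
- transitivity (RInt (fun t => scal 1 (f (1 * t + d))) a b).
  + apply RInt_ext. intros t _. symmetry. apply E.
  + rewrite <- (Rmult_1_l a) at 2. rewrite <- (Rmult_1_l b) at 2.
    exact (RInt_comp_lin f 1 d a b H).
Qed.

(** * Real suprema and infima *)

Lemma Rsup_is_lub (E : R -> Prop) (M : R) :
  (exists r, E r) -> (forall r, E r -> r <= M) -> is_lub E (Rsup E).
Proof.
intros [r0 Hr0] HM. unfold Rsup.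
destruct (Lub_Rbar_correct E) as [Hub Hleast].
pose proof (Hub r0 Hr0) as H0.
assert (H1 : Rbar_le (Lub_Rbar E) M) by (apply Hleast; intros r Hr; exact (HM r Hr)).
destruct (Lub_Rbar E) as [l| |]; simpl in *; try easy.
split.
- intros r Hr. exact (Hub r Hr).
- intros u Hu. apply (Hleast u). intros r Hr. exact (Hu r Hr).
Qed.

Lemma Rinf_bounds (E : R -> Prop) (m : R) :
  (exists r, E r) -> (forall r, E r -> m <= r) ->
  (forall r, E r -> Rinf E <= r) /\
  (forall c, (forall r, E r -> c <= r) -> c <= Rinf E).
Proof.
intros [r0 Hr0] Hm. unfold Rinf.
destruct (Glb_Rbar_correct E) as [Hlb Hgreatest].
pose proof (Hlb r0 Hr0) as H0.
assert (H1 : Rbar_le m (Glb_Rbar E)) by (apply Hgreatest; intros r Hr; exact (Hm r Hr)).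
destruct (Glb_Rbar E) as [l| |]; simpl in *; try easy.
split.
- intros r Hr. exact (Hlb r Hr).
- intros c Hc. apply (Hgreatest c). intros r Hr. exact (Hc r Hr).
Qed.

Lemma sup_norm_is_lub {Z : Type} (f : Z -> R) :
  inhabited Z -> ell_inf f ->
  is_lub (fun r => exists z, r = Rabs (f z)) (sup_norm f).
Proof.
intros [z0] [M HM]. apply (Rsup_is_lub _ M).
- now exists (Rabs (f z0)), z0.
- intros r [z ->]. apply HM.
Qed.

Lemma ell_inf_plus {Z : Type} (f g : Z -> R) :
  ell_inf f -> ell_inf g -> ell_inf (fun z => f z + g z).
Proof.
intros [M HM] [N HN]. exists (M + N). intros z.
eapply Rle_trans; [apply Rabs_triang|]. specialize (HM z); specialize (HN z); lra.
Qed.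

Lemma ell_inf_scal {Z : Type} (c : R) (f : Z -> R) :
  ell_inf f -> ell_inf (fun z => c * f z).
Proof.
intros [M HM]. exists (Rabs c * M). intros z.
rewrite Rabs_mult. apply Rmult_le_compat_l; [apply Rabs_pos|apply HM].
Qed.

Lemma ell_inf_const {Z : Type} (c : R) : ell_inf (fun _ : Z => c).
Proof. exists (Rabs c). intros _; lra. Qed.

Lemma ell_inf_minus {Z : Type} (f g : Z -> R) :
  ell_inf f -> ell_inf g -> ell_inf (fun z => f z - g z).
Proof.
intros [M HM] [N HN]. exists (M + N). intros z.
specialize (HM z); specialize (HN z).
revert HM HN; unfold Rabs; repeat destruct Rcase_abs; intros; lra.
Qed.

Section AveragedSuprema.
Variables (X : Metric_Space) (A : Base X -> Prop).
Hypothesis (A_nonempty : exists a, A a) (A_closed : is_closed X A).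

Local Notation rho := (dist_to_set X A).

(** * The distance to a set *)

Lemma dist_to_set_bounds (x : Base X) :
  (forall a, A a -> rho x <= dist X x a) /\
  (forall c, (forall a, A a -> c <= dist X x a) -> c <= rho x).
Proof.
destruct A_nonempty as [a0 Ha0].
destruct (Rinf_bounds (fun r => exists a, A a /\ r = dist X x a) 0) as [H1 H2].
- exists (dist X x a0), a0; auto.
- intros r (a & _ & ->). apply Rge_le, dist_pos.
- split.
  + intros a Ha. apply H1. now exists a.
  + intros c Hc. apply H2. intros r (a & Ha & ->). auto.
Qed.

Lemma dist_to_set_near (x : Base X) (t : R) :
  rho x < t -> exists a : {x | A x}, dist X (proj1_sig a) x < t.
Proof.
intros Ht. destruct (excluded_middle_informative
  (exists a : {x | A x}, dist X (proj1_sig a) x < t)) as [H|H]; [exact H|].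
exfalso. assert (t <= rho x); [|lra].
apply dist_to_set_bounds. intros a Ha. apply Rnot_lt_le. intros Hlt.
apply H. exists (exist _ a Ha). simpl. now rewrite dist_sym.
Qed.

Lemma dist_to_set_lipschitz (x y : Base X) : rho x <= rho y + dist X x y.
Proof.
cut (rho x - dist X x y <= rho y); [lra|].
apply dist_to_set_bounds. intros a Ha.
pose proof (proj1 (dist_to_set_bounds x) a Ha). pose proof (dist_tri X x a y). lra.
Qed.

Lemma dist_to_set_pos (x : Base X) : ~ A x -> 0 < rho x.
Proof.
intros Hx. destruct (A_closed x Hx) as (e & He & Hfar).
enough (e <= rho x) by lra.
apply dist_to_set_bounds. intros a Ha. apply Rnot_lt_le. intros Hlt.
exact (Hfar a Hlt Ha).
Qed.

Lemma not_in_set_near (x y : Base X) : dist X x y < rho x -> ~ A y.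
Proof.
intros Hxy Hy. pose proof (proj1 (dist_to_set_bounds x) y Hy). lra.
Qed.

(** * The increasing function averaged by the extension *)

Lemma eta_is_lub (phi : {x | A x} -> R) (x : Base X) (t : R) :
  ell_inf phi -> rho x < t ->
  is_lub (fun r => exists a : {x | A x}, dist X (proj1_sig a) x < t /\ r = phi a)
    (eta X A phi x t).
Proof.
intros [M HM] Ht. unfold eta. destruct Rlt_dec as [_|]; [|easy].
apply (Rsup_is_lub _ M).
- destruct (dist_to_set_near x t Ht) as [a Ha]. now exists (phi a), a.
- intros r (a & _ & ->). specialize (HM a). pose proof (Rle_abs (phi a)). lra.
Qed.

Lemma eta_ge_value (phi : {x | A x} -> R) (x : Base X) (t : R) (a : {x | A x}) :
  ell_inf phi -> rho x < t -> dist X (proj1_sig a) x < t -> phi a <= eta X A phi x t.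
Proof.
intros Hphi Ht Ha. apply (eta_is_lub phi x t Hphi Ht). now exists a.
Qed.

Lemma eta_le_bound (phi : {x | A x} -> R) (x : Base X) (t c : R) :
  ell_inf phi -> rho x < t ->
  (forall a, dist X (proj1_sig a) x < t -> phi a <= c) -> eta X A phi x t <= c.
Proof.
intros Hphi Ht Hc. apply (eta_is_lub phi x t Hphi Ht).
intros r (a & Ha & ->). auto.
Qed.

Lemma eta_le_rho (phi : {x | A x} -> R) (x : Base X) (t : R) :
  ell_inf phi -> t <= rho x ->
  (forall a, eta X A phi x t <= phi a) /\
  (forall c, (forall a, c <= phi a) -> c <= eta X A phi x t).
Proof.
intros [M HM] Ht. unfold eta. destruct Rlt_dec as [|_]; [lra|].
destruct (Rinf_bounds (fun r => exists a : {x | A x}, r = phi a) (- M)) as [H1 H2].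
- destruct A_nonempty as [a0 Ha0]. now exists (phi (exist _ a0 Ha0)), (exist _ a0 Ha0).
- intros r [a ->]. specialize (HM a). pose proof (Rle_abs (- phi a)).
  rewrite Rabs_Ropp in *. lra.
- split; [intros a; apply H1; now exists a|].
  intros c Hc. apply H2. intros r [a ->]. auto.
Qed.

Lemma eta_bounded (phi : {x | A x} -> R) (M : R) (x : Base X) (t : R) :
  (forall a, Rabs (phi a) <= M) -> Rabs (eta X A phi x t) <= M.
Proof.
intros HM. assert (Hphi : ell_inf phi) by (now exists M).
assert (HM' : forall a, - M <= phi a <= M) by (intros a; apply Rabs_le_between, HM).
apply Rabs_le. destruct (Rlt_dec (rho x) t) as [Ht|Ht].
- destruct (dist_to_set_near x t Ht) as [a Ha].
  pose proof (eta_ge_value phi x t a Hphi Ht Ha). split; [specialize (HM' a); lra|].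
  apply eta_le_bound; auto. intros b _. apply HM'.
- apply Rnot_lt_le in Ht. destruct (eta_le_rho phi x t Hphi Ht) as [H1 H2].
  destruct A_nonempty as [a0 Ha0]. specialize (H1 (exist _ a0 Ha0)).
  specialize (HM' (exist _ a0 Ha0)) as H0. split; [|lra].
  apply H2. intros a; apply HM'.
Qed.

Lemma eta_monotone (phi : {x | A x} -> R) (x : Base X) (s t : R) :
  ell_inf phi -> s <= t -> eta X A phi x s <= eta X A phi x t.
Proof.
intros Hphi Hst. destruct (Rlt_dec (rho x) s) as [Hs|Hs].
- apply eta_le_bound; auto. intros a Ha. apply eta_ge_value; auto; lra.
- apply Rnot_lt_le in Hs. destruct (Rlt_dec (rho x) t) as [Ht|Ht].
  + destruct (dist_to_set_near x t Ht) as [a Ha].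
    apply (Rle_trans _ (phi a)); [now apply eta_le_rho|now apply eta_ge_value].
  + apply Rnot_lt_le in Ht. apply (eta_le_rho phi x t Hphi Ht).
    now apply eta_le_rho.
Qed.

Lemma eta_ex_RInt (phi : {x | A x} -> R) (x : Base X) (a b : R) :
  ell_inf phi -> ex_RInt (eta X A phi x) a b.
Proof.
intros Hphi. destruct (Rle_dec a b) as [H|H]; [|apply ex_RInt_swap];
  (apply ex_RInt_monotone; [lra|]); intros s t _ Hst _; now apply eta_monotone.
Qed.

Lemma eta_is_well_behaved (phi : {x | A x} -> R) (x : Base X) :
  ell_inf phi -> eta_well_behaved X A phi x.
Proof.
intros Hphi. split; [|split].
- destruct Hphi as [M HM]. exists M. intros t _. now apply eta_bounded.
- intros s t _ Hst. now apply eta_monotone.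
- now apply eta_ex_RInt.
Qed.

Lemma eta_plus (phi psi : {x | A x} -> R) (x : Base X) (t : R) :
  ell_inf phi -> ell_inf psi -> rho x < t ->
  eta X A (fun a => phi a + psi a) x t <= eta X A phi x t + eta X A psi x t.
Proof.
intros Hphi Hpsi Ht. apply eta_le_bound; auto using ell_inf_plus.
intros a Ha. apply Rplus_le_compat; now apply eta_ge_value.
Qed.

Lemma eta_scal_le (phi : {x | A x} -> R) (c : R) (x : Base X) (t : R) :
  0 <= c -> ell_inf phi -> rho x < t ->
  eta X A (fun a => c * phi a) x t <= c * eta X A phi x t.
Proof.
intros Hc Hphi Ht. apply eta_le_bound; auto using ell_inf_scal.
intros a Ha. apply Rmult_le_compat_l; [exact Hc|]. now apply eta_ge_value.
Qed.

Lemma eta_scal (phi : {x | A x} -> R) (c : R) (x : Base X) (t : R) :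
  0 <= c -> ell_inf phi -> rho x < t ->
  eta X A (fun a => c * phi a) x t = c * eta X A phi x t.
Proof.
intros Hc Hphi Ht. apply Rle_antisym; [now apply eta_scal_le|].
destruct Hc as [Hc|<-].
- apply (Rmult_le_reg_l (/ c)); [now apply Rinv_0_lt_compat|].
  rewrite <- Rmult_assoc, Rinv_l, Rmult_1_l by lra.
  apply eta_le_bound; auto. intros a Ha.
  apply (Rmult_le_reg_l c); [exact Hc|].
  rewrite <- Rmult_assoc, Rinv_r, Rmult_1_l by lra.
  apply (eta_ge_value (fun a => c * phi a)); auto using ell_inf_scal.
- rewrite Rmult_0_l. destruct (dist_to_set_near x t Ht) as [a Ha].
  rewrite <- (Rmult_0_l (phi a)) at 1.
  apply (eta_ge_value (fun a => 0 * phi a)); auto using ell_inf_scal.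
Qed.

Lemma eta_isotone (phi psi : {x | A x} -> R) (x : Base X) (t : R) :
  ell_inf phi -> ell_inf psi -> (forall a, phi a <= psi a) -> rho x < t ->
  eta X A phi x t <= eta X A psi x t.
Proof.
intros Hphi Hpsi Hle Ht. apply eta_le_bound; auto.
intros a Ha. apply (Rle_trans _ (psi a)); [apply Hle|now apply eta_ge_value].
Qed.

(** A point of [A] that is closer than [t] to [y] is closer than
    [t + dist X x y] to [x]. *)
Lemma eta_translate (phi : {x | A x} -> R) (x y : Base X) (t : R) :
  ell_inf phi -> rho y < t ->
  eta X A phi y t <= eta X A phi x (t + dist X x y).
Proof.
intros Hphi Ht. apply eta_le_bound; auto. intros a Ha. apply eta_ge_value; auto.
- pose proof (dist_to_set_lipschitz x y). lra.
- pose proof (dist_tri X (proj1_sig a) x y). rewrite (dist_sym X y x) in *. lra.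
Qed.

(** * The extension operator *)

Lemma Phi_on_set : extension_operator X A (Phi X A).
Proof.
intros phi _ [a Ha]. unfold Phi; simpl.
destruct excluded_middle_informative as [H|]; [|easy].
now rewrite (proof_irrelevance _ H Ha).
Qed.

Lemma Phi_off_set (phi : {x | A x} -> R) (x : Base X) : ~ A x ->
  Phi X A phi x = / rho x * RInt (eta X A phi x) (rho x) (2 * rho x).
Proof.
intros Hx. unfold Phi. now destruct excluded_middle_informative.
Qed.

Lemma Phi_off_set_mul (phi : {x | A x} -> R) (x : Base X) : ~ A x ->
  rho x * Phi X A phi x = RInt (eta X A phi x) (rho x) (2 * rho x).
Proof.
intros Hx. rewrite Phi_off_set by exact Hx.
pose proof (dist_to_set_pos x Hx). field. lra.
Qed.

(** Every [t] in the range of averaging is below [2 * rho x], so only these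
    points of [A] enter the suprema. *)
Lemma Phi_local_bounds (phi : {x | A x} -> R) (x : Base X) (m M : R) :
  ell_inf phi -> ~ A x ->
  (forall a, dist X (proj1_sig a) x < 2 * rho x -> m <= phi a <= M) ->
  m <= Phi X A phi x <= M.
Proof.
intros Hphi Hx Hb. pose proof (dist_to_set_pos x Hx) as Hpos.
assert (Hc : forall c, RInt (fun _ => c) (rho x) (2 * rho x) = rho x * c).
{ intros c. rewrite RInt_const. unfold scal; simpl; unfold mult; simpl. ring. }
assert (Heta : forall t, rho x < t < 2 * rho x -> m <= eta X A phi x t <= M).
{ intros t Ht. split.
  - destruct (dist_to_set_near x t) as [a Ha]; [lra|].
    apply (Rle_trans _ (phi a)); [apply Hb; lra|apply eta_ge_value; auto; lra].
  - apply eta_le_bound; auto; [lra|]. intros a Ha. apply Hb; lra. }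
split; apply (Rmult_le_reg_l (rho x)); auto;
  rewrite Phi_off_set_mul by exact Hx; rewrite <- Hc;
  (apply RInt_le; [lra| | |]);
  try apply ex_RInt_const; try (now apply eta_ex_RInt);
  intros t Ht; now apply Heta.
Qed.

Lemma Phi_bounds (phi : {x | A x} -> R) (m M : R) (x : Base X) :
  ell_inf phi -> (forall a, m <= phi a <= M) -> m <= Phi X A phi x <= M.
Proof.
intros Hphi Hb. destruct (excluded_middle_informative (A x)) as [Hx|Hx].
- change x with (proj1_sig (exist A x Hx)). now rewrite Phi_on_set.
- now apply Phi_local_bounds.
Qed.

Lemma Phi_Rabs_le (phi : {x | A x} -> R) (M : R) (x : Base X) :
  (forall a, Rabs (phi a) <= M) -> Rabs (Phi X A phi x) <= M.
Proof.
intros HM. apply Rabs_le, Phi_bounds; [now exists M|].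
intros a. apply Rabs_le_between, HM.
Qed.

Lemma Phi_maps_ell_inf : maps_ell_inf (Phi X A).
Proof.
intros phi [M HM]. exists M. intros x. now apply Phi_Rabs_le.
Qed.

Lemma Phi_isotone : isotone (Phi X A).
Proof.
intros phi psi Hphi Hpsi Hle x.
destruct (excluded_middle_informative (A x)) as [Hx|Hx].
- change x with (proj1_sig (exist A x Hx)). now rewrite !Phi_on_set.
- pose proof (dist_to_set_pos x Hx).
  apply (Rmult_le_reg_l (rho x)); auto. rewrite !Phi_off_set_mul by exact Hx.
  apply RInt_le; try now apply eta_ex_RInt.
  + lra.
  + intros t Ht. now apply eta_isotone.
Qed.

Lemma Phi_sublinear : sublinear (Phi X A).
Proof.
split.
- intros phi psi Hphi Hpsi x.
  destruct (excluded_middle_informative (A x)) as [Hx|Hx].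
  + change x with (proj1_sig (exist A x Hx)).
    rewrite !Phi_on_set by auto using ell_inf_plus. lra.
  + pose proof (dist_to_set_pos x Hx).
    apply (Rmult_le_reg_l (rho x)); auto.
    rewrite Rmult_plus_distr_l, !Phi_off_set_mul by exact Hx.
    rewrite <- (RInt_plus (V := R_CompleteNormedModule)) by now apply eta_ex_RInt.
    apply RInt_le; [lra| | |].
    * now apply eta_ex_RInt, ell_inf_plus.
    * apply (ex_RInt_plus (V := R_NormedModule)); now apply eta_ex_RInt.
    * intros t Ht. now apply eta_plus.
- intros c phi Hc Hphi x.
  destruct (excluded_middle_informative (A x)) as [Hx|Hx].
  + change x with (proj1_sig (exist A x Hx)).
    now rewrite !Phi_on_set by auto using ell_inf_scal.
  + pose proof (dist_to_set_pos x Hx).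
    apply (Rmult_eq_reg_l (rho x)); [|lra].
    rewrite <- Rmult_assoc, (Rmult_comm (rho x) c), Rmult_assoc, !Phi_off_set_mul by exact Hx.
    transitivity (RInt (fun t => scal c (eta X A phi x t)) (rho x) (2 * rho x)).
    * apply RInt_ext. rewrite Rmin_left, Rmax_right by lra.
      intros t Ht. now apply eta_scal.
    * exact (RInt_scal (V := R_CompleteNormedModule) _ _ _ c (eta_ex_RInt _ _ _ _ Hphi)).
Qed.

(** Subadditivity, applied to [psi] and a constant, and monotonicity. *)
Lemma Phi_le_plus_const (phi psi : {x | A x} -> R) (c : R) (x : Base X) :
  ell_inf phi -> ell_inf psi -> (forall a, phi a <= psi a + c) ->
  Phi X A phi x <= Phi X A psi x + c.
Proof.
intros Hphi Hpsi Hle.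
pose proof (ell_inf_const (Z := {x | A x}) c) as Hcst.
pose proof (Phi_isotone _ _ Hphi (ell_inf_plus _ _ Hpsi Hcst) Hle x).
pose proof (proj1 Phi_sublinear _ _ Hpsi Hcst x).
(* With equal bounds, [Phi] maps the constant [c] to itself. *)
pose proof (Phi_bounds (fun _ => c) c c x Hcst (fun _ => conj (Rle_refl c) (Rle_refl c))).
simpl in *; lra.
Qed.

Lemma Phi_isometry : isometry (Phi X A).
Proof.
intros phi psi Hphi Hpsi. destruct A_nonempty as [a0 Ha0].
destruct (sup_norm_is_lub (fun z => Phi X A phi z - Phi X A psi z)) as [U1 L1].
{ exact (inhabits a0). }
{ apply ell_inf_minus; now apply Phi_maps_ell_inf. }
destruct (sup_norm_is_lub (fun a => phi a - psi a)) as [U2 L2].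
{ exact (inhabits (exist _ a0 Ha0)). }
{ now apply ell_inf_minus. }
apply Rle_antisym.
- apply L1. intros r [x ->].
  assert (B : forall a, Rabs (phi a - psi a) <= sup_norm (fun a => phi a - psi a)).
  { intros a. apply U2. now exists a. }
  assert (B' : forall a, - sup_norm (fun a => phi a - psi a) <= phi a - psi a
      <= sup_norm (fun a => phi a - psi a)) by (intros a; apply Rabs_le_between, B).
  apply Rabs_le. split.
  + enough (Phi X A psi x <= Phi X A phi x + sup_norm (fun a => phi a - psi a)) by lra.
    apply Phi_le_plus_const; auto. intros a; specialize (B' a); lra.
  + enough (Phi X A phi x <= Phi X A psi x + sup_norm (fun a => phi a - psi a)) by lra.
    apply Phi_le_plus_const; auto. intros a; specialize (B' a); lra.
- apply L2. intros r [a ->]. apply U1. exists (proj1_sig a).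
  now rewrite !Phi_on_set.
Qed.

(** * Continuity of the extension *)

(** If [d(z,a) < delta / 3], then [rho z < delta / 3], so that the points of
    [A] closer than [2 * rho z] to [z] are closer than [delta] to [a]. *)
Lemma Phi_near_set (phi : {x | A x} -> R) (a : {x | A x}) (e delta : R) (z : Base X) :
  ell_inf phi ->
  (forall b : {x | A x}, dist X (proj1_sig b) (proj1_sig a) < delta ->
     Rabs (phi b - phi a) <= e) ->
  dist X z (proj1_sig a) < delta / 3 ->
  Rabs (Phi X A phi z - phi a) <= e.
Proof.
intros Hphi Hosc Hz.
pose proof (dist_pos X z (proj1_sig a)).
destruct (excluded_middle_informative (A z)) as [Az|Az].
- change z with (proj1_sig (exist A z Az)). rewrite Phi_on_set by exact Hphi.
  apply Hosc. simpl. lra.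
- assert (Hr : rho z <= dist X z (proj1_sig a)).
  { apply dist_to_set_bounds. exact (proj2_sig a). }
  enough (phi a - e <= Phi X A phi z <= phi a + e) by (apply Rabs_le; lra).
  apply Phi_local_bounds; auto. intros b Hb.
  assert (Hba : Rabs (phi b - phi a) <= e).
  { apply Hosc. pose proof (dist_tri X (proj1_sig b) (proj1_sig a) z). lra. }
  apply Rabs_le_between in Hba. lra.
Qed.

(** Translating by [d(x,y)] bounds the integral for [y] by the integral of
    [eta phi x] over an interval whose ends differ from those of the interval
    for [x] by at most [2 * d(x,y)] and [3 * d(x,y)]. *)
Lemma Phi_mul_lipschitz (phi : {x | A x} -> R) (M : R) (x y : Base X) :
  (forall a, Rabs (phi a) <= M) -> ~ A x -> ~ A y ->
  rho y * Phi X A phi y <= rho x * Phi X A phi x + 5 * M * dist X x y.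
Proof.
intros HM Hx Hy. assert (Hphi : ell_inf phi) by (now exists M).
rewrite !Phi_off_set_mul by assumption.
pose proof (dist_to_set_pos y Hy) as Hpos.
pose proof (dist_to_set_lipschitz x y) as L1.
pose proof (dist_to_set_lipschitz y x) as L2. rewrite (dist_sym X y x) in L2.
pose proof (Rge_le _ _ (dist_pos X x y)) as Hd.
set (d := dist X x y) in *.
destruct (RInt_translate (eta X A phi x) d (rho y) (2 * rho y)) as [I E].
{ now apply eta_ex_RInt. }
apply (Rle_trans _ (RInt (fun t => eta X A phi x (t + d)) (rho y) (2 * rho y))).
{ apply RInt_le; [lra|now apply eta_ex_RInt|exact I|].
  intros t Ht. now apply eta_translate. }
rewrite E.
assert (HM0 : 0 <= M).
{ destruct A_nonempty as [a0 Ha0]. pose proof (HM (exist _ a0 Ha0)).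
  pose proof (Rabs_pos (phi (exist _ a0 Ha0))). lra. }
eapply Rle_trans.
{ apply (RInt_change_bounds (eta X A phi x) M (rho x) (2 * rho x)).
  - intros t. now apply eta_bounded.
  - intros u v. now apply eta_ex_RInt. }
apply Rplus_le_compat_l.
replace (5 * M * d) with (M * (2 * d + 3 * d)) by ring.
apply Rmult_le_compat_l; [exact HM0|].
apply Rplus_le_compat; apply Rabs_le; lra.
Qed.

(** The function [rho * Phi phi] is [5 * M]-Lipschitz off [A]; dividing by the
    1-Lipschitz function [rho] costs another [M], as [|Phi phi| <= M]. *)
Lemma Phi_lipschitz_off_set (phi : {x | A x} -> R) (M : R) (x y : Base X) :
  (forall a, Rabs (phi a) <= M) -> ~ A x -> ~ A y ->
  rho x * Rabs (Phi X A phi x - Phi X A phi y) <= 6 * M * dist X x y.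
Proof.
intros HM Hx Hy.
pose proof (Phi_mul_lipschitz phi M x y HM Hx Hy) as H1.
pose proof (Phi_mul_lipschitz phi M y x HM Hy Hx) as H2.
pose proof (dist_to_set_lipschitz x y) as L1.
pose proof (dist_to_set_lipschitz y x) as L2. rewrite (dist_sym X y x) in L2, H2.
pose proof (Rge_le _ _ (dist_pos X x y)) as Hd.
pose proof (dist_to_set_pos x Hx) as Hpos.
assert (B : Rabs ((rho y - rho x) * Phi X A phi y) <= dist X x y * M).
{ rewrite Rabs_mult. apply Rmult_le_compat; try apply Rabs_pos.
  - apply Rabs_le; lra.
  - now apply Phi_Rabs_le. }
apply Rabs_le_between in B.
rewrite <- (Rabs_pos_eq (rho x)) at 1 by lra. rewrite <- Rabs_mult.
replace (rho x * (Phi X A phi x - Phi X A phi y)) with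
  (rho x * Phi X A phi x - rho y * Phi X A phi y + (rho y - rho x) * Phi X A phi y) by ring.
apply Rabs_le; lra.
Qed.

(** On [{x | r <= rho x}] the Lipschitz constant [6 * M / rho x] is at most
    [6 * M / r], and taking [delta <= r] keeps [y] off [A]. *)
Lemma Phi_close_off_set (phi : {x | A x} -> R) (r eps : R) :
  ell_inf phi -> 0 < r -> 0 < eps ->
  exists delta, 0 < delta /\ forall x y,
    r <= rho x -> dist X x y < delta -> Rabs (Phi X A phi x - Phi X A phi y) < eps.
Proof.
intros [M HM] Hr Heps.
assert (HM0 : 0 <= M).
{ destruct A_nonempty as [a0 Ha0]. pose proof (HM (exist _ a0 Ha0)).
  pose proof (Rabs_pos (phi (exist _ a0 Ha0))). lra. }
(* The summand 1 keeps the denominator positive when [M] is 0. *)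
assert (Hq : 0 < r * eps / (6 * M + 1)).
{ apply Rdiv_lt_0_compat; [now apply Rmult_lt_0_compat|lra]. }
exists (Rmin r (r * eps / (6 * M + 1))). split; [now apply Rmin_glb_lt|].
intros x y Hx Hxy.
pose proof (Rmin_l r (r * eps / (6 * M + 1))).
pose proof (Rmin_r r (r * eps / (6 * M + 1))).
assert (Nx : ~ A x).
{ apply (not_in_set_near x). rewrite (proj2 (dist_refl X x x) eq_refl). lra. }
assert (Ny : ~ A y) by (apply (not_in_set_near x); lra).
pose proof (Phi_lipschitz_off_set phi M x y HM Nx Ny) as HL.
pose proof (Rge_le _ _ (dist_pos X x y)) as Hd.
pose proof (Rabs_pos (Phi X A phi x - Phi X A phi y)) as Habs.
apply (Rmult_lt_reg_l r); [exact Hr|].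
apply (Rle_lt_trans _ ((6 * M + 1) * dist X x y)).
- apply (Rle_trans _ (rho x * Rabs (Phi X A phi x - Phi X A phi y))).
  + now apply Rmult_le_compat_r.
  + lra.
- replace (r * eps) with ((6 * M + 1) * (r * eps / (6 * M + 1))) by (field; lra).
  apply Rmult_lt_compat_l; lra.
Qed.

Lemma Phi_preserves_continuity : preserves_continuity X A (Phi X A).
Proof.
intros phi Hphi Hcont x eps Heps. simpl in *.
destruct (excluded_middle_informative (A x)) as [Hx|Hx].
- destruct (Hcont (exist _ x Hx) (eps / 2)) as (delta & Hdelta & H); [lra|].
  exists (delta / 3). split; [lra|]. intros z [_ Hz].
  change x with (proj1_sig (exist A x Hx)) at 1. rewrite Phi_on_set by exact Hphi.
  apply (Rle_lt_trans _ (eps / 2)); [|lra].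
  apply (Phi_near_set phi (exist A x Hx) (eps / 2) delta z Hphi); [|exact Hz].
  intros b Hb. apply Rlt_le. now apply H.
- destruct (Phi_close_off_set phi (rho x) eps Hphi (dist_to_set_pos x Hx) Heps)
    as (delta & Hdelta & H).
  exists delta. split; [exact Hdelta|]. intros y [_ Hy].
  unfold Rdist. rewrite Rabs_minus_sym. apply H; [lra|]. now rewrite dist_sym.
Qed.

Lemma Phi_preserves_unif_continuity : preserves_unif_continuity X A (Phi X A).
Proof.
intros phi Hphi Hcont eps Heps.
destruct (Hcont (eps / 3)) as (delta & Hdelta & H); [lra|]. simpl in H.
destruct (Phi_close_off_set phi (delta / 6) eps Hphi) as (delta' & Hdelta' & H'); [lra|lra|].
exists (Rmin (delta / 6) delta'). split; [apply Rmin_glb_lt; lra|].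
intros x y Hxy.
pose proof (Rmin_l (delta / 6) delta'). pose proof (Rmin_r (delta / 6) delta').
destruct (Rle_dec (delta / 6) (rho x)) as [Hr|Hr].
- apply H'; [exact Hr|lra].
- (* A point of [A] within [delta / 6] of [x] is within [delta / 3] of [x] and [y]. *)
  destruct (dist_to_set_near x (delta / 6)) as [a Ha]; [lra|].
  assert (Hosc : forall b : {x | A x}, dist X (proj1_sig b) (proj1_sig a) < delta ->
     Rabs (phi b - phi a) <= eps / 3).
  { intros b Hb. apply Rlt_le. now apply H. }
  rewrite dist_sym in Ha.
  assert (Bx : Rabs (Phi X A phi x - phi a) <= eps / 3).
  { apply (Phi_near_set phi a _ delta); auto. lra. }
  assert (By : Rabs (Phi X A phi y - phi a) <= eps / 3).
  { apply (Phi_near_set phi a _ delta); auto.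
    pose proof (dist_tri X y (proj1_sig a) x) as T. rewrite (dist_sym X y x) in T. lra. }
  apply Rabs_le_between in Bx, By. apply Rabs_def1; lra.
Qed.

End AveragedSuprema.

Theorem theorem4p1 (X : Metric_Space) (A : Base X -> Prop)
    (A_nonempty : exists a, A a) (A_closed : is_closed X A) :
  (forall (phi : {x | A x} -> R) (x : Base X),
     ell_inf phi -> ~ A x -> eta_well_behaved X A phi x) /\
  maps_ell_inf (Phi X A) /\
  extension_operator X A (Phi X A) /\
  sublinear (Phi X A) /\
  isotone (Phi X A) /\
  isometry (Phi X A) /\
  preserves_continuity X A (Phi X A) /\
  preserves_unif_continuity X A (Phi X A).
Proof.
repeat split.
- now apply eta_is_well_behaved.
- now apply eta_is_well_behaved.
- now apply eta_is_well_behaved.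
- now apply Phi_maps_ell_inf.
- now apply Phi_on_set.
- now apply Phi_sublinear.
- now apply Phi_sublinear.
- now apply Phi_isotone.
- now apply Phi_isometry.
- now apply Phi_preserves_continuity.
- now apply Phi_preserves_unif_continuity.
Qed.
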